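(* For any graph $G$ with maximum degree $\Delta(G)\ge 4$, we have $\chi_\ell^\star(G)\le \chi_c^\star(G)\le 2\Delta(G)-2$.
   Context: A correspondence-cover of a graph $G$ is a pair $(L,H)$ where $H$ is a graph and $L:V(G)\to 2^{V(H)}$ is such that: the sets $L(v)$ partition $V(H)$; for distinct non-adjacent $u,v$ there are no edges of $H$ between $L(u)$ and $L(v)$; for $uv\in E(G)$ the edges of $H$ between $L(u)$ and $L(v)$ form a matching; each $L(v)$ induces a clique in $H$. It is $k$-fold if $|L(v)|=k$ for all $v$. A $k$-list-assignment $L$ assigns each vertex a set $L(v)\subseteq\mathbb{N}$ of size $k$; its list-cover has vertices $x_v$ ($v\in V(G)$, $x\in L(v)$), cliques on each $\{x_v:x\in L(v)\}$, and edges $x_ux_v$ for each $uv\in E(G)$ and $x\in L(u)\cap L(v)$. The list packing number $\chi_\ell^\star(G)$ is the least $k$ such that for every $k$-list-assignment the associated list-cover has chromatic number $k$ (equivalently, there are $k$ pairwise disjoint proper $L$-colourings). The correspondence packing number $\chi_c^\star(G)$ is the least $k$ such that every $k$-fold correspondence-cover $(L,H)$ of $G$ has $\chi(H)=k$. *)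

(* Defs.v *)
From HB Require Import structures.
From mathcomp Require Import all_boot finmap.

Set Implicit Arguments.
Unset Strict Implicit.
Unset Printing Implicit Defensive.

Record sgraph := SGraph {
  vertex :> finType;
  adj : rel vertex;
  adj_sym : symmetric adj;
  adj_irr : irreflexive adj }.

Section Graph.
Variable G : sgraph.

Definition max_degree : nat := \max_(v : G) #|[set w : G | adj v w]|.

Definition colourable (k : nat) : bool :=
  [exists f : {ffun G -> 'I_k}, forall x, forall y, adj x y ==> (f x != f y)].

Lemma ex_colourable : exists k, colourable k.
Proof.
exists #|G|; apply/existsP; exists [ffun x => enum_rank x].
apply/forallP => x; apply/forallP => y; apply/implyP => xy; rewrite !ffunE.
by apply: contraTneq xy => /enum_rank_inj ->; rewrite adj_irr.
Qed.

Definition chromatic_number : nat := ex_minn ex_colourable.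
End Graph.

Section Packing.
Variable G : sgraph.

(* [exists!] rather than [partition]: the family [L] is indexed by the vertices
   of [G], so distinct vertices must receive disjoint sets. *)
Definition correspondence_cover (H : sgraph) (L : G -> {set H}) : Prop :=
  [/\ forall x : H, exists! v : G, x \in L v,
      forall (u v : G) (x y : H), u != v -> ~~ adj u v ->
        x \in L u -> y \in L v -> ~~ adj x y,
      forall (u v : G) (x x' y y' : H), adj u v ->
        x \in L u -> x' \in L u -> y \in L v -> y' \in L v ->
        adj x y -> adj x' y' -> (x = x' <-> y = y')
    & forall (v : G) (x y : H), x \in L v -> y \in L v -> x != y -> adj x y].

Definition fold_cover (k : nat) (H : sgraph) (L : G -> {set H}) : Prop :=
  correspondence_cover L /\ forall v, #|L v| = k.

Definition list_assignment (k : nat) (L : G -> {fset nat}) : Prop :=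
  forall v, #|` L v|%fset = k.

Section ListCover.
Variable L : G -> {fset nat}.

(* The vertex x_v is the dependent pair of v : G and x : L v. *)
Definition list_cover_vertex : finType := {v : G & L v}.

Definition list_cover_adj (a b : list_cover_vertex) : bool :=
  (tag a == tag b) && (val (tagged a) != val (tagged b))
  || adj (tag a) (tag b) && (val (tagged a) == val (tagged b)).

Lemma list_cover_sym : symmetric list_cover_adj.
Proof.
move=> a b; rewrite /list_cover_adj adj_sym.
by rewrite [tag a == _]eq_sym [val (tagged a) == _]eq_sym.
Qed.

Lemma list_cover_irr : irreflexive list_cover_adj.
Proof. by move=> a; rewrite /list_cover_adj !eqxx adj_irr. Qed.

Definition list_cover : sgraph := SGraph list_cover_sym list_cover_irr.
End ListCover.

(* Positivity matters: for k = 0 the only cover is the empty graph, which has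
   chromatic number 0, so 0 would satisfy either condition for every [G]. *)
Definition least_positive (P : nat -> Prop) (k : nat) : Prop :=
  [/\ 0 < k, P k & forall j, 0 < j -> P j -> k <= j].

Definition is_list_packing_number : nat -> Prop :=
  least_positive (fun k => forall L : G -> {fset nat},
    list_assignment k L -> chromatic_number (list_cover L) = k).

Definition is_correspondence_packing_number : nat -> Prop :=
  least_positive (fun k => forall (H : sgraph) (L : G -> {set H}),
    fold_cover k L -> chromatic_number H = k).

End Packing.

(* Main.v *)
Require Import Defs.
From mathcomp Require Import all_boot all_fingroup finmap zify.
From Stdlib Require Import Classical.

(* Put D = max degree, d = D - 1 and k = 2d.  A k-colouring of a k-fold cover is
   a bijection from each list to the k colours.  When at most d neighbours of a
   vertex are coloured, the admissible (list element, colour) pairs form a balanced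
   bipartite graph on 2d + 2d vertices of minimum degree at least d, which has a
   perfect matching by Hall's theorem; so greedy colouring stops only at a vertex v
   all of whose D neighbours are coloured.  Then uncolour one neighbour u: now u and
   v both have at most d coloured neighbours, and after identifying their lists along
   the matching of the cover, colouring both means finding disjoint perfect matchings
   in two such bipartite graphs, which is possible as soon as d >= 3: if no perfect
   matching of the second graph avoids a perfect matching f of the first, then a
   deficient set forces, up to swapping the sides, d vertices to have neighbourhoods
   {f x} + N with a common N, and re-choosing the first matching so that it differs
   from f at two of these vertices removes every obstruction. *)

Set Implicit Arguments.
Unset Strict Implicit.
Unset Printing Implicit Defensive.

(** * Hall's marriage theorem *)

Definition neighbours (T U : finType) (B : T -> U -> bool) (X : {set T}) :=
  [set y | [exists x in X, B x y]].

Lemma neighbours_sub (T U : finType) (B : T -> U -> bool) (X : {set T}) x :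
  x \in X -> [set y | B x y] \subset neighbours B X.
Proof.
by move=> xX; apply/subsetP => y; rewrite !inE => Bxy; apply/existsP; exists x; rewrite xX.
Qed.

(** Induction on [#|S|]. If some nonempty proper subset [X] is tight, match [X] first, then
    [S :\: X] into the vertices outside the neighbourhood of [X]. Otherwise every such subset has a
    surplus, so any edge at [x0] can be fixed and its ends removed. [u0] is the value of [f] when
    [S] is empty. *)
Lemma hall (T U : finType) (B : T -> U -> bool) (u0 : U) (S : {set T}) :
  (forall X : {set T}, X \subset S -> #|X| <= #|neighbours B X|) ->
  exists f : T -> U, {in S &, injective f} /\ {in S, forall x, B x (f x)}.
Proof.
have [n] := ubnP #|S|; elim: n B S => // n IHn B S; rewrite ltnS => leSn hB.
have [->|[x0 x0S]] := set_0Vmem S.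
  by exists (fun=> u0); split=> [x y|x]; rewrite inE.
case: (boolP [exists X : {set T},
    [&& X != set0, X \proper S & #|neighbours B X| <= #|X|]]) => [|noX].
  move=> /existsP [X /and3P [X0 XS tight]].
  have ltXn : #|X| < n by apply: leq_trans leSn; apply: proper_card.
  have [f [injf fB]] := IHn B X ltXn
    (fun Y sYX => hB Y (subset_trans sYX (proper_sub XS))).
  pose B' x y := B x y && (y \notin neighbours B X).
  have ltDn : #|S :\: X| < n.
    apply: leq_trans leSn; apply: proper_card; rewrite properE subsetDl /=.
    have [x xX] := set0Pn _ X0; apply/subsetPn; exists x; last by rewrite inE xX.
    exact: (subsetP (proper_sub XS)).
  have hB' (Y : {set T}) : Y \subset S :\: X -> #|Y| <= #|neighbours B' Y|.
    rewrite subsetD => /andP [sYS dYX].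
    have sU : X :|: Y \subset S by rewrite subUset sYS (proper_sub XS).
    (* Hall's condition for [X :|: Y], less the at most [#|X|] neighbours of the tight set [X], is
       Hall's condition for [Y] in [B']. *)
    have := hB _ sU; rewrite cardsU disjoint_setI0 1?disjoint_sym // cards0 subn0.
    have sub : neighbours B (X :|: Y) \subset neighbours B X :|: neighbours B' Y.
      apply/subsetP => y; rewrite [y \in neighbours B (_ :|: _)]inE => /existsP [x /andP [xU Bxy]].
      rewrite inE; case: (boolP (y \in neighbours B X)) => //= yX.
      rewrite inE; apply/existsP; exists x; rewrite /B' Bxy yX !andbT.
      move: xU; rewrite inE => /orP [xX|//]; case/negP: yX; rewrite inE.
      by apply/existsP; exists x; rewrite xX.
    have := subset_leq_card sub; have := cardsU (neighbours B X) (neighbours B' Y); lia.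
  have [g [injg gB]] := IHn B' _ ltDn hB'.
  exists (fun x => if x \in X then f x else g x); split=> [x y xS yS|x xS] /=.
    have mixed a b : a \in X -> b \in S -> b \notin X -> f a <> g b.
      move=> aX bS bX eab; have := gB b; rewrite inE bX bS => /(_ isT).
      rewrite /B' -eab => /andP [_ /negP []]; rewrite inE.
      by apply/existsP; exists a; rewrite aX fB.
    case: ifPn => xX; case: ifPn => yX.
    - exact: injf.
    - by move=> e; case: (mixed x y).
    - by move=> e; case: (mixed y x).
    - by apply: injg; rewrite inE ?xX ?yX.
  case: ifPn => xX; first exact: fB.
  by have := gB x; rewrite inE xX xS => /(_ isT) /andP [].
have [y0 Bxy0] : exists y, B x0 y.
  have : #|[set x0]| <= #|neighbours B [set x0]| by apply: hB; rewrite sub1set.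
  rewrite cards1 card_gt0 => /set0Pn [y]; rewrite inE => /existsP [x].
  by rewrite inE => /andP [/eqP -> ?]; exists y.
pose B' x y := B x y && (y != y0).
have ltDn : #|S :\ x0| < n by rewrite (cardsD1 x0) x0S in leSn.
have hB' (Y : {set T}) : Y \subset S :\ x0 -> #|Y| <= #|neighbours B' Y|.
  move=> sY; have [->|Y0] := eqVneq Y set0; first by rewrite cards0.
  have sYS : Y \proper S.
    by apply: sub_proper_trans sY _; rewrite properD1.
  move: noX => /existsPn /(_ Y); rewrite Y0 sYS /= -ltnNge.
  have sub : neighbours B Y \subset y0 |: neighbours B' Y.
    apply/subsetP => y; rewrite !inE => /existsP [x /andP [xY Bxy]].
    case: eqVneq => //= yy0; apply/existsP; exists x.
    by rewrite xY /B' Bxy yy0.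
  by have := subset_leq_card sub; rewrite cardsU1; lia.
have [g [injg gB]] := IHn B' _ ltDn hB'.
have gy x : x \in S -> x != x0 -> g x <> y0.
  move=> xS xx0 e; have := gB x; rewrite !inE xx0 xS => /(_ isT).
  by rewrite /B' e eqxx andbF.
exists (fun x => if x == x0 then y0 else g x); split=> [x y xS yS|x xS] /=.
  case: eqVneq => [->|xx0]; case: eqVneq => [->|yx0] //.
  - by move=> e; case: (gy y).
  - by move=> e; case: (gy x).
  - by apply: injg; rewrite !inE ?xx0 ?yx0.
case: eqVneq => [->//|xx0].
by have := gB x; rewrite !inE xx0 xS => /(_ isT) /andP [].
Qed.

Lemma hall_perm (T : finType) (B : rel T) :
  (exists p : {perm T}, forall x, B x (p x)) \/
  (exists S : {set T}, #|neighbours B S| < #|S|).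
Proof.
case: (boolP [exists S : {set T}, #|neighbours B S| < #|S|]) => [/existsP|noS].
  by right.
left; have [t0|T0] := pickP T; last by exists 1%g => x; have := T0 x.
have [|f [injf fB]] := @hall T T B t0 setT.
  by move=> X _; move/existsPn: noS => /(_ X); rewrite -leqNgt.
have injf' : injective f by move=> x y; apply: injf; rewrite inE.
by exists (perm injf') => x; rewrite permE; apply: fB; rewrite inE.
Qed.

(** * Perfect matchings in balanced bipartite graphs, and what obstructs avoiding one *)

Definition min_degree (T : finType) (d : nat) (B : rel T) :=
  (forall x, d <= #|[set y | B x y]|) /\ (forall y, d <= #|[set x | B x y]|).

Definition transpose (T : finType) (B : rel T) : rel T := fun x y => B y x.

Lemma transpose_neighbours (T : finType) (B : rel T) (S : {set T}) y :
  y \notin neighbours B S -> [set x | B x y] \subset ~: S.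
Proof.
move=> yN; apply/subsetP => x; rewrite !inE => Bxy; apply: contra yN => xS.
by rewrite inE; apply/existsP; exists x; rewrite xS.
Qed.

Lemma card_D1_le (T : finType) (X Y : {set T}) a :
  X \subset a |: Y -> #|X| <= #|Y|.+1.
Proof. by move/subset_leq_card; rewrite cardsU1; case: (_ \notin _) => /=; lia. Qed.

(** Delete the two pairs and apply Hall. The pairs share no end, so each degree drops by at most
    one, and only at [x1], [x2], [y1], [y2]. A deficient [S] with neighbourhood [N] would have
    [d <= #|N|] and [d <= #|~: S|], hence [#|S| <= d <= #|N|]. *)
Lemma perfect_matching_avoid2 (T : finType) (d : nat) (B : rel T) (x1 x2 y1 y2 : T) :
  2 < d -> #|T| = d.*2 -> min_degree d B -> x1 != x2 -> y1 != y2 ->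
  exists p : {perm T}, [/\ forall x, B x (p x), p x1 != y1 & p x2 != y2].
Proof.
move=> d3 cardT [rowB colB] x12 y12.
pose B' : rel T := fun x y => [&& B x y, (x, y) != (x1, y1) & (x, y) != (x2, y2)].
have [[p pB]|[S violS]] := hall_perm B'.
  exists p; split=> [x||]; first by have /and3P [] := pB x.
    by have /and3P [_] := pB x1; rewrite xpair_eqE eqxx.
  by have /and3P [_ _] := pB x2; rewrite xpair_eqE eqxx.
exfalso.
have row_ge x : d <= #|[set y | B' x y]| + (x \in [set x1; x2]).
  apply: leq_trans (rowB x) _; rewrite !inE.
  case: eqVneq => [->|xx1]; [|case: eqVneq => [->|xx2]] => /=.
  - rewrite addn1; apply: (@card_D1_le _ _ _ y1); apply/subsetP => y.
    by rewrite !inE /B' !xpair_eqE eqxx (negPf x12) /= => ->; case: (y == y1).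
  - rewrite addn1; apply: (@card_D1_le _ _ _ y2); apply/subsetP => y.
    by rewrite !inE /B' !xpair_eqE eqxx [x2 == x1]eq_sym (negPf x12) /= => ->; case: (y == y2).
  - rewrite addn0; apply: subset_leq_card; apply/subsetP => y.
    by rewrite !inE /B' !xpair_eqE (negPf xx1) (negPf xx2) /= andbT.
have col_ge y : d <= #|[set x | B' x y]| + (y \in [set y1; y2]).
  apply: leq_trans (colB y) _; rewrite !inE.
  case: eqVneq => [->|yy1]; [|case: eqVneq => [->|yy2]] => /=.
  - rewrite addn1; apply: (@card_D1_le _ _ _ x1); apply/subsetP => x.
    by rewrite !inE /B' !xpair_eqE eqxx (negPf y12) !andbF !andbT /= => ->; case: (x == x1).
  - rewrite addn1; apply: (@card_D1_le _ _ _ x2); apply/subsetP => x.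
    by rewrite !inE /B' !xpair_eqE eqxx [y2 == y1]eq_sym (negPf y12) !andbF !andbT /= => ->; case: (x == x2).
  - rewrite addn0; apply: subset_leq_card; apply/subsetP => x.
    by rewrite !inE /B' !xpair_eqE (negPf yy1) (negPf yy2) !andbF /= andbT.
set N := neighbours B' S in violS.
have rowN x : x \in S -> #|[set y | B' x y]| <= #|N|.
  by move=> xS; apply/subset_leq_card/neighbours_sub.
have colN y : y \in ~: N -> #|[set x | B' x y]| <= #|~: S|.
  by rewrite inE => yN; apply/subset_leq_card/transpose_neighbours.
have cS := cardsC S; have cN := cardsC N; rewrite cardT in cS cN.
have dN : d <= #|N|.
  (* A vertex of [S] other than [x1], [x2] keeps [d] neighbours. Otherwise [#|S| <= 2], so
     [#|N| <= 1], below the remaining degree [d - 1 >= 2]. *)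
  have [sS|/subsetPn [x xS xX]] := boolP (S \subset [set x1; x2]).
    have := subset_leq_card sS; rewrite cards2 x12 => S2.
    have /card_gt0P [x xS] : 0 < #|S| by lia.
    by have := row_ge x; have := rowN x xS; case: (_ \in _); lia.
  by have := row_ge x; have := rowN x xS; rewrite (negPf xX); lia.
have dS : d <= #|~: S|.
  have [sN|/subsetPn [y yN yY]] := boolP (~: N \subset [set y1; y2]).
    have := subset_leq_card sN; rewrite cards2 y12 => N2.
    have /card_gt0P [y yN] : 0 < #|~: N| by lia.
    by have := col_ge y; have := colN y yN; case: (_ \in _); lia.
  by have := col_ge y; have := colN y yN; rewrite (negPf yY); lia.
lia.
Qed.

(* Deleting the edges of [p] leaves the [d] vertices of [S] with the [d.-1]
   neighbours [N], so Hall's condition fails. *)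
Definition blocked (T : finType) (d : nat) (B : rel T) (p : {perm T}) (S N : {set T}) :=
  [/\ #|S| = d, #|N| = d.-1 &
      forall x, x \in S -> [set y | B x y] = p x |: N /\ p x \notin N].

(** Each [x] in [S] has at least [d] neighbours inside [p x |: N], a set of at most [d] elements,
    which forces equality. [S] is then cut down to exactly [d] elements. *)
Lemma blockedI (T : finType) (d : nat) (B : rel T) (p : {perm T}) (S N : {set T}) :
  0 < d -> (forall x, d <= #|[set y | B x y]|) -> d <= #|S| -> #|N| = d.-1 ->
  (forall x, x \in S -> [set y | B x y && (y != p x)] \subset N) ->
  exists S' : {set T}, blocked d B p S' N.
Proof.
move=> d0 rowB dS cN sub.
have [S' [sS' cS']] : exists S' : {set T}, S' \subset S /\ #|S'| = d.
  exists [set x in take d (enum S)]; split.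
    by apply/subsetP => x; rewrite inE => /mem_take; rewrite mem_enum.
  rewrite cardsE; have /card_uniqP -> := take_uniq d (enum_uniq S).
  by rewrite size_takel // -cardE.
exists S'; split=> // x /(subsetP sS') xS.
have sB : [set y | B x y] \subset p x |: N.
  apply/subsetP => y; rewrite !inE => Bxy; case: eqVneq => //= ypx.
  by apply: (subsetP (sub x xS)); rewrite inE Bxy.
have := subset_leq_card sB; have := rowB x; rewrite cardsU1.
case: (boolP (p x \in N)) => /= pN h1 h2; first by lia.
split=> //; apply/eqP; rewrite eqEcard sB cardsU1 pN /=; lia.
Qed.

(** A deficient set [S] for [B] without the edges of [p] satisfies [d - 1 <= #|N| < #|S| <= d + 1].
    If [#|N| = d - 1], then [S] and [N] block [p]. Otherwise [#|N| = d] and [#|S| = d + 1], and the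
    complements of [N] and [S] block the inverse of [p] in the transpose. *)
Lemma perfect_matching_or_blocked (T : finType) (d : nat) (B : rel T) (p : {perm T}) :
  0 < d -> #|T| = d.*2 -> min_degree d B ->
  [\/ exists q : {perm T}, forall x, B x (q x) && (q x != p x),
      exists S N : {set T}, blocked d B p S N
    | exists S N : {set T}, blocked d (transpose B) p^-1 S N].
Proof.
move=> d0 cardT [rowB colB].
pose B' : rel T := fun x y => B x y && (y != p x).
have [[q qB]|[S violS]] := hall_perm B'; first by constructor 1; exists q.
set N := neighbours B' S in violS.
have rowN x : x \in S -> [set y | B' x y] \subset N by apply: neighbours_sub.
have colN y : y \in ~: N -> [set x | B' x y] \subset ~: S.
  by rewrite inE => yN; apply: transpose_neighbours.
have cS := cardsC S; have cN := cardsC N; rewrite cardT in cS cN.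
have dN : d <= #|N|.+1.
  have /card_gt0P [x xS] : 0 < #|S| by lia.
  apply: leq_trans (rowB x) _; apply: (@card_D1_le _ _ _ (p x)).
  apply/subsetP => y; rewrite in_setU1 inE => Bxy; case: eqVneq => //= ypx.
  by apply: (subsetP (rowN x xS)); rewrite inE /B' Bxy ypx.
have dS : d <= #|~: S|.+1.
  have /card_gt0P [y yN] : 0 < #|~: N| by lia.
  apply: leq_trans (colB y) _; apply: (@card_D1_le _ _ _ (p^-1 y)%g).
  apply/subsetP => x; rewrite in_setU1 inE => Bxy; case: eqVneq => //= xpy.
  apply: (subsetP (colN y yN)); rewrite inE /B' Bxy /=.
  by apply: contraNneq xpy => ->; rewrite permK.
have [Nsmall|Nbig] := eqVneq #|N| d.-1.
  constructor 2.
  have leS : d <= #|S| by lia.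
  have [S' ?] := blockedI d0 rowB leS Nsmall rowN.
  by exists S', N.
constructor 3.
have [||x xN|S' ?] := @blockedI T d (transpose B) (p^-1)%g (~: N) (~: S) d0 colB.
- by lia.
- by lia.
- apply: subset_trans (colN x xN); apply/subsetP => y; rewrite !inE /transpose /B'.
  move=> /andP [-> /=]; apply: contra => /eqP ->; by rewrite permK.
by exists S', (~: S).
Qed.

(* A vertex outside [N] is adjacent to at most one member of [S], hence to all
   members of [~: S] but at most one ([miss]); so the neighbourhoods of two members
   of [S' :\: S] make up exactly [~: N], which excludes both a third such member
   and a member of [S' :&: S]. *)
Lemma blocked_not_blocked (T : finType) (d : nat) (B : rel T) (f p : {perm T})
    (S N S' N' : {set T}) (x1 x2 : T) :
  2 < d -> #|T| = d.*2 -> min_degree d B -> blocked d B f S N ->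
  x1 \in S -> x2 \in S -> x1 != x2 -> p x1 != f x1 -> p x2 != f x2 ->
  ~ blocked d B p S' N'.
Proof.
move=> d3 cardT [rowB colB] [cS cN hS] x1S x2S x12 px1 px2 [cS' cN' hS'].
have cTN := cardsC N; have cTS := cardsC S; rewrite cardT cS cN in cTN cTS.
have NB x y : x \in S -> B x y = (y == f x) || (y \in N).
  by move=> /hS [/setP /(_ y)]; rewrite !inE.
have NB' x y : x \in S' -> B x y = (y == p x) || (y \in N').
  by move=> /hS' [/setP /(_ y)]; rewrite !inE.
have miss u u' t : u \notin S -> u' \notin S -> u != u' -> t \notin N -> B u t || B u' t.
  move=> uS u'S uu' tN; apply/norP => -[But Bu't].
  have : #|[set x | B x t]| <= (#|~: S :\ u :\ u'|).+1.
    apply: (@card_D1_le _ _ _ (f^-1 t)%g); apply/subsetP => x; rewrite in_setU1 !inE => Bxt.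
    case: (eqVneq x u') Bxt => [->|_] Bxt; first by rewrite Bxt in Bu't.
    case: (eqVneq x u) Bxt => [->|_] Bxt; first by rewrite Bxt in But.
    case: (boolP (x \in S)) => xS; rewrite ?orbT ?orbF //=.
    by move: Bxt; rewrite NB // (negPf tN) orbF => /eqP ->; rewrite permK.
  have := colB t; have := cardsD1 u (~: S); have := cardsD1 u' (~: S :\ u).
  by rewrite !inE uS u'S eq_sym uu' /=; clear - d3 cTS; lia.
have cover u u' : u \in S' :\: S -> u' \in S' :\: S -> u != u' ->
    ~: N = [set p u; p u'] :|: N'.
  rewrite !inE => /andP [uS uS'] /andP [u'S u'S'] uu'.
  apply/eqP; rewrite eqEcard; apply/andP; split.
    apply/subsetP => t; rewrite !inE => tN; have := miss u u' t uS u'S uu' tN.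
    by rewrite !NB' //; case: (t == p u); case: (t == p u'); case: (t \in N').
  by have := cardsU [set p u; p u'] N'; rewrite cards2; case: (_ != _); clear - d3 cTN cN'; lia.
have split' := cardsID S S'.
have [big|small] := ltnP 1 #|S' :\: S|.
  have /card_gt1P [u [u' [uU u'U uu']]] := big.
  have cov := cover u u' uU u'U uu'.
  have [SS'0|[x]] := set_0Vmem (S' :&: S).
    rewrite SS'0 cards0 add0n in split'.
    have /card_gt0P [u''] : 0 < #|S' :\: S :\ u :\ u'|.
      have := cardsD1 u (S' :\: S); have := cardsD1 u' (S' :\: S :\ u).
      by rewrite [u' \in _ :\ _]in_setD1 uU u'U eq_sym uu' /=; clear - d3 split' cS'; lia.
    rewrite !in_setD1 => /and3P [u''u' u''u u''U].
    have : p u'' \in ~: N by rewrite (cover u u'') // 1?eq_sym // !inE eqxx orbT.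
    rewrite cov !inE !(inj_eq perm_inj) (negPf u''u) (negPf u''u') /=.
    by case: (hS' u'') => [|_ /negPf -> //]; move: u''U; rewrite inE => /andP [].
  rewrite inE => /andP [xS' xS].
  (* [N'] avoids [N] by [cov], yet lies in the neighbourhood [f x |: N] of [x]. *)
  have : #|N'| <= #|[set f x]|.
    apply: subset_leq_card; apply/subsetP => y yN'; rewrite inE.
    have : B x y by rewrite NB' // yN' orbT.
    rewrite NB // => /orP [//|yN].
    have : y \in ~: N by rewrite cov inE yN' orbT.
    by rewrite inE yN.
  by rewrite cards1; clear - d3 cN'; lia.
(* Now at least [d - 1] members of [S'] lie in [S]. Two of them have only [N] as common neighbours,
   so [N' = N] and [p] agrees with [f] on [S' :&: S]. This excludes [x1] and [x2], leaving at most
   [d - 2] members. *)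
have big : 1 < #|S' :&: S| by clear - d3 split' small cS'; lia.
have /card_gt1P [x [x' []]] := big.
rewrite !inE => /andP [xS' xS] /andP [x'S' x'S] xx'.
have eN : N' = N.
  apply/eqP; rewrite eqEcard cN cN' leqnn andbT; apply/subsetP => y yN'.
  have : B x y by rewrite NB' // yN' orbT.
  have : B x' y by rewrite NB' // yN' orbT.
  rewrite !NB //; case: (y \in N); rewrite ?orbT // !orbF => /eqP -> /eqP /perm_inj.
  by move=> e; rewrite e eqxx in xx'.
have pf z : z \in S' -> z \in S -> p z = f z.
  move=> zS' zS; have : B z (p z) by rewrite NB' // eqxx.
  rewrite NB // => /orP [/eqP //|]; rewrite -eN.
  by case: (hS' z zS') => _ /negPf ->.
have : #|S' :&: S| <= #|S :\ x1 :\ x2|.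
  apply: subset_leq_card; apply/subsetP => z; rewrite !inE => /andP [zS' zS].
  rewrite zS andbT; apply/andP; split.
    by apply: contraNneq px2 => <-; rewrite pf.
  by apply: contraNneq px1 => <-; rewrite pf.
have := cardsD1 x1 S; have := cardsD1 x2 (S :\ x1).
by rewrite !inE x1S x2S eq_sym x12 /=; clear - d3 split' small cS cS'; lia.
Qed.

(** The set [S'] must avoid [N], and also [f x1] and [f x2]. But [~: N] has [d + 1] elements, so
    only [d - 1] remain for the [d] members of [S']. *)
Lemma blocked_not_blocked_transpose (T : finType) (d : nat) (B : rel T)
    (f p : {perm T}) (S N S' N' : {set T}) (x1 x2 : T) :
  2 < d -> #|T| = d.*2 -> blocked d B f S N ->
  x1 \in S -> x2 \in S -> x1 != x2 -> p x1 != f x1 -> p x2 != f x2 ->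
  ~ blocked d (transpose B) p^-1 S' N'.
Proof.
move=> d3 cardT [cS cN hS] x1S x2S x12 px1 px2 [cS' cN' hS'].
have cTN := cardsC N; rewrite cardT cN in cTN.
have NB x y : x \in S -> B x y = (y == f x) || (y \in N).
  by move=> /hS [/setP /(_ y)]; rewrite !inE.
have NB' x y : y \in S' -> B x y = (x == p^-1 y)%g || (x \in N').
  by move=> /hS' [/setP /(_ x)]; rewrite /transpose in_setU1 inE.
have S'N : S' \subset ~: N.
  have [/exists_inP [t tS' tN]|/exists_inPn sS'N] := boolP [exists t in S', t \notin N]; last first.
    have : #|S'| <= #|N|.
      by apply/subset_leq_card/subsetP => t /sS'N; rewrite negbK.
    by clear - d3 cN cS'; lia.
  apply/subsetP => n nS'; rewrite inE; apply/negP => nN.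
  (* All of [S] is adjacent to [n], whose degree is at most [d], so [S] is its whole neighbourhood
     and contains [N']. Every member of [N'] is adjacent to [t], which lies outside [N], so [N']
     contains at most the preimage of [t] under [f]. *)
  have eS : S = [set x | B x n].
    apply/eqP; rewrite eqEcard; apply/andP; split.
      by apply/subsetP => x xS; rewrite inE NB // nN orbT.
    by case: (hS' n nS') => -> _; rewrite cardsU1; case: (_ \notin _) => /=; clear - d3 cS cN'; lia.
  have : #|N'| <= #|[set (f^-1 t)%g]|.
    apply/subset_leq_card/subsetP => x xN'; rewrite inE.
    have xS : x \in S by rewrite eS inE NB' // xN' orbT.
    have : B x t by rewrite NB' // xN' orbT.
    by rewrite NB // (negPf tN) orbF => /eqP ->; rewrite permK.
  by rewrite cards1; clear - d3 cN'; lia.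
(* If [f x] were in [S'], then [x] would not be in [N'], since it has no other neighbour in [S'].
   The edge from [x] to [f x] would therefore belong to [p]. *)
have absurd x : x \in S -> p x != f x -> f x \notin S'.
  move=> xS pfx; apply/negP => fS'.
  have xN' : x \notin N'.
    have /card_gt0P [t] : 0 < #|S' :\ f x|.
      by have := cardsD1 (f x) S'; case: (_ \in _) => /=; clear - d3 cS'; lia.
    rewrite !inE => /andP [tfx tS']; apply/negP => xN'.
    have : B x t by rewrite NB' // xN' orbT.
    rewrite NB // (negPf tfx) /=; have := subsetP S'N t tS'.
    by rewrite inE => /negPf ->.
  have : B x (f x) by rewrite NB // eqxx.
  rewrite NB' // (negPf xN') orbF => /eqP e; move: pfx.
  by rewrite [in p x]e permKV eqxx.
have : #|S'| <= #|~: N :\ f x1 :\ f x2|.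
  apply/subset_leq_card/subsetP => y yS'; rewrite !in_setD1 (subsetP S'N) // andbT.
  apply/andP; split; apply: contraTneq yS' => ->; exact: absurd.
have := cardsD1 (f x1) (~: N); have := cardsD1 (f x2) (~: N :\ f x1).
rewrite !inE (inj_eq perm_inj) eq_sym x12 /=.
have [_ ->] := hS _ x1S; have [_ ->] := hS _ x2S => /=; clear - d3 cTN cS'; lia.
Qed.

(** * Two disjoint perfect matchings *)

Lemma disjoint_matchings_blocked (T : finType) (d : nat) (B1 B2 : rel T)
    (f : {perm T}) (S N : {set T}) :
  2 < d -> #|T| = d.*2 -> min_degree d B1 -> min_degree d B2 ->
  blocked d B2 f S N ->
  exists p q : {perm T}, forall x, [&& B1 x (p x), B2 x (q x) & p x != q x].
Proof.
move=> d3 cardT h1 h2 bl.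
have /card_gt1P [x1 [x2 [x1S x2S x12]]] : 1 < #|S| by case: bl; lia.
have f12 : f x1 != f x2 by rewrite (inj_eq perm_inj).
have [p [pB px1 px2]] := perfect_matching_avoid2 d3 cardT h1 x12 f12.
have [||[S' [N' bl']]|[S' [N' bl']]] := @perfect_matching_or_blocked T d B2 p _ cardT h2.
- by lia.
- by move=> [q qB]; exists p, q => x; rewrite pB /= eq_sym; exact: qB.
- by case: (blocked_not_blocked d3 cardT h2 bl x1S x2S x12 px1 px2 bl').
- by case: (blocked_not_blocked_transpose d3 cardT bl x1S x2S x12 px1 px2 bl').
Qed.

Lemma disjoint_matchings (T : finType) (d : nat) (B1 B2 : rel T) :
  2 < d -> #|T| = d.*2 -> min_degree d B1 -> min_degree d B2 ->
  exists p q : {perm T}, forall x, [&& B1 x (p x), B2 x (q x) & p x != q x].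
Proof.
move=> d3 cardT h1 h2.
have /card_gt1P [x1 [x2 [_ _ x12]]] : 1 < #|T| by lia.
(* Any perfect matching of [B1] will do here; the avoided pairs are arbitrary. *)
have [p [pB _ _]] := perfect_matching_avoid2 d3 cardT h1 x12 x12.
have [||[S [N bl]]|[S [N bl]]] := @perfect_matching_or_blocked T d B2 p _ cardT h2.
- by lia.
- by move=> [q qB]; exists p, q => x; rewrite pB /= eq_sym; exact: qB.
- exact: (disjoint_matchings_blocked d3 cardT h1 h2 bl).
have [h1r h1c] := h1; have [h2r h2c] := h2.
(* The obstruction lies on the other side: solve the transposed problem and invert both
   matchings. *)
have [p' [q pq]] := disjoint_matchings_blocked d3 cardT
  (conj h1c h1r : min_degree d (transpose B1)) (conj h2c h2r : min_degree d (transpose B2)) bl.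
exists (p'^-1)%g, (q^-1)%g => x; apply/and3P; split.
- by have /and3P [] := pq (p'^-1 x)%g; rewrite permKV.
- by have /and3P [_] := pq (q^-1 x)%g; rewrite permKV.
- apply/eqP => e; have /and3P [_ _] := pq (p'^-1 x)%g.
  by rewrite permKV e permKV eqxx.
Qed.

(** * Packing a cover vertex by vertex *)

(** The domain and the image of a partial injection have complements of equal size, which are paired
    off in enumeration order. This identifies the lists of two adjacent vertices along the matching
    between them. *)
Lemma perm_extending (T : finType) (M : rel T) :
  (forall i j i' j', M i j -> M i' j' -> (i = i' <-> j = j')) ->
  exists s : {perm T}, forall i j, M i j -> s i = j.
Proof.
move=> matching.
pose D := [set i | [exists j, M i j]].
pose h i := odflt i [pick j | M i j].
have hM i j : M i j -> h i = j.
  move=> Mij; rewrite /h; case: pickP => [j' Mij'|/(_ j)]; last by rewrite Mij.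
  by apply/(matching _ _ _ _ Mij' Mij).
have injh : {in D &, injective h}.
  move=> i i'; rewrite !inE => /existsP [j Mij] /existsP [j' Mij'].
  by rewrite (hM _ _ Mij) (hM _ _ Mij') => /(matching _ _ _ _ Mij Mij').
pose E := ~: (h @: D).
have cE : size (enum E) = size (enum (~: D)).
  rewrite -!cardE; have := cardsC D; have := cardsC (h @: D).
  by rewrite card_in_imset // /E; lia.
pose g i := if i \in D then h i else nth i (enum E) (index i (enum (~: D))).
have idx i : i \notin D -> index i (enum (~: D)) < size (enum E).
  by move=> iD; rewrite cE index_mem mem_enum inE.
have gE i : i \notin D -> g i \in E.
  by move=> iD; rewrite -mem_enum /g (negPf iD) mem_nth ?idx.
have gD i : i \in D -> g i \notin E.
  by move=> iD; rewrite inE negbK /g iD imset_f.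
have injg : injective g.
  move=> i i' e; case: (boolP (i \in D)) => iD; case: (boolP (i' \in D)) => i'D.
  - by move: e; rewrite /g iD i'D; apply: injh.
  - by have := gE _ i'D; rewrite -e (negPf (gD _ iD)).
  - by have := gE _ iD; rewrite e (negPf (gD _ i'D)).
  - move: e; rewrite /g (negPf iD) (negPf i'D) (set_nth_default i) ?idx //.
    move/eqP; rewrite nth_uniq ?idx ?enum_uniq // => /eqP.
    by apply: (index_inj i); rewrite mem_enum inE.
exists (perm injg) => i j Mij; rewrite permE /g (hM _ _ Mij) inE.
by case: existsP => // -[]; exists j.
Qed.

Section Packing.
Variables (G : sgraph) (T : finType) (d : nat) (m : G -> G -> rel T).
Hypothesis d_gt2 : 2 < d.
Hypothesis cardT : #|T| = d.*2.
Hypothesis degree_le : forall v : G, #|[set w | adj v w]| <= d.+1.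
Hypothesis m_sym : forall u v i j, m u v i j = m v u j i.
Hypothesis m_matching : forall u v : G, adj u v ->
  forall i j i' j', m u v i j -> m u v i' j' -> (i = i' <-> j = j').

(** [T] indexes both the members of each list and the colours: [c u i] is the colour of the [i]-th
    member of the list of [u]. Taking [c u] to be a permutation encodes proper colouring of the list
    cliques, so only cover edges between lists remain to be checked. *)
Definition packed (X : {set G}) (c : G -> {perm T}) :=
  forall u v i j, u \in X -> v \in X -> adj u v -> m u v i j -> c u i != c v j.

Definition allowed (X : {set G}) (c : G -> {perm T}) (v : G) : rel T := fun i a =>
  [forall w in X, adj v w ==> [forall j, m v w i j ==> (c w j != a)]].

Lemma allowedP (X : {set G}) (c : G -> {perm T}) v i a :
  reflect (forall w j, w \in X -> adj v w -> m v w i j -> c w j != a)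
          (allowed X c v i a).
Proof.
apply: (iffP forall_inP) => [ok w j wX vw mij|ok w wX].
  by have /implyP /(_ vw) /forallP /(_ j) /implyP := ok w wX; exact.
by apply/implyP => vw; apply/forallP => j; apply/implyP; exact: ok.
Qed.

Lemma notallowedP (X : {set G}) (c : G -> {perm T}) v i a : ~~ allowed X c v i a ->
  exists w j, [/\ w \in [set w in X | adj v w], adj v w, m v w i j & c w j = a].
Proof.
rewrite negb_forall_in => /exists_inP [w wX]; rewrite negb_imply => /andP [vw].
rewrite negb_forall => /existsP [j]; rewrite negb_imply negbK => /andP [mij /eqP cwj].
by exists w, j; split=> //; rewrite inE wX.
Qed.

(** Since [m v w] is a matching, each coloured neighbour [w] forbids at most one colour for a given
    list member, and at most one list member for a given colour. Of [2d] candidates at least [d]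
    survive. *)
Lemma allowed_min_degree (X : {set G}) (c : G -> {perm T}) v :
  #|[set w in X | adj v w]| <= d -> min_degree d (allowed X c v).
Proof.
move=> degX.
have large (A : {set T}) (F : G -> T) :
    ~: A \subset F @: [set w in X | adj v w] -> d <= #|A|.
  move=> /subset_leq_card; have := leq_imset_card F [set w in X | adj v w].
  have := cardsC A; lia.
split=> [i|a].
  (* The function sends [w] to the one colour it can forbid; the default value occurs only when [w]
     forbids none. *)
  apply: (large _ (fun w => c w (odflt i [pick j | m v w i j]))).
  apply/subsetP => a; rewrite !inE => /notallowedP [w [j [wX vw mij cwj]]].
  apply/imsetP; exists w => //; rewrite -cwj; congr (c w _).
  case: pickP => [j' mij'|/(_ j)]; last by rewrite mij.
  by apply/(m_matching vw mij mij').
apply: (large _ (fun w => odflt a [pick i | m v w i ((c w)^-1 a)%g])).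
apply/subsetP => i; rewrite !inE => /notallowedP [w [j [wX vw mij cwj]]].
apply/imsetP; exists w => //; rewrite -cwj permK.
case: pickP => [i' mij'|/(_ i)]; last by rewrite mij.
by apply/(m_matching vw mij mij').
Qed.

(* A vertex [v] with a packed neighbour [u] is added together with [u], which is
   first unpacked: then each of them has at most [d] packed neighbours. *)
Lemma packed_extend (X : {set G}) (c : G -> {perm T}) v :
  v \notin X -> packed X c -> exists c', packed (v |: X) c'.
Proof.
move=> vX pc; case: (boolP [exists u in X, adj v u]) => [/exists_inP [u uX vu]|/exists_inPn noNv].
  pose Y := X :\ u.
  have degY x y : adj x y -> y \notin Y -> #|[set w in Y | adj x w]| <= d.
    move=> xy yY; have := degree_le x; rewrite (cardsD1 y) inE xy add1n ltnS.
    apply: leq_trans; apply/subset_leq_card/subsetP => w; rewrite !in_setD1 !inE.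
    move=> /andP [wY ->]; rewrite andbT; apply: contraNneq yY => <-.
    by rewrite !inE.
  have uY : u \notin Y by rewrite !inE eqxx.
  have vY : v \notin Y by rewrite inE (negPf vX) andbF.
  have [B1row B1col] := @allowed_min_degree Y c v (degY _ _ vu uY).
  have uv : adj u v by rewrite adj_sym.
  have [B2row B2col] := @allowed_min_degree Y c u (degY _ _ uv vY).
  have [s sP] := perm_extending (m_matching vu).
  (* Reindexing the list of [u] by that of [v] through [s] turns every conflict along the edge [vu]
     into an equality [p i = q i], which disjointness excludes. *)
  pose B2 : rel T := fun i a => allowed Y c u (s i) a.
  have hB2 : min_degree d B2.
    split=> [i|a]; first exact: B2row.
    have -> : [set i | B2 i a] = s @^-1: [set i | allowed Y c u i a].
      by apply/setP => i; rewrite !inE.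
    by rewrite card_preimset //; exact: perm_inj.
  have [p [q pq]] := disjoint_matchings d_gt2 cardT (conj B1row B1col) hB2.
  pose c' w := if w == v then p else if w == u then (s^-1 * q)%g else c w.
  have nuv : (u == v) = false by apply: contraTF uX => /eqP ->.
  have vP i : allowed Y c v i (c' v i).
    by rewrite /c' eqxx; case/and3P: (pq i).
  have uP i : allowed Y c u i (c' u i).
    rewrite /c' nuv eqxx permM; have /and3P [_] := pq (s^-1 i)%g.
    by rewrite /B2 permKV.
  have uvP i j : m v u i j -> c' v i != c' u j.
    move=> /sP <-; rewrite /c' nuv !eqxx permM permK.
    by case/and3P: (pq i).
  have YP w : w \in Y -> c' w = c w.
    rewrite !inE /c' => /andP [/negPf -> wX]; case: eqVneq => // wv.
    by rewrite -wv wX in vX.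
  exists c' => a b i j aX bX ab mij.
  have cases w : w \in v |: X -> [\/ w = v, w = u | w \in Y].
    rewrite !inE; case: (eqVneq w v) => [->|_]; first by constructor 1.
    case: (eqVneq w u) => [->|_] /= wX; first by constructor 2.
    by constructor 3.
  case: (cases a aX) => [ea|ea|aY]; case: (cases b bX) => [eb|eb|bY].
  - by move: ab; rewrite ea eb adj_irr.
  - by rewrite ea eb uvP // -ea -eb.
  - rewrite ea (YP b) // eq_sym; move/allowedP: (vP i); apply=> //; by rewrite -ea.
  - by rewrite ea eb eq_sym uvP // m_sym -ea -eb.
  - by move: ab; rewrite ea eb adj_irr.
  - rewrite ea (YP b) // eq_sym; move/allowedP: (uP i); apply=> //; by rewrite -ea.
  - rewrite eb (YP a) //; move/allowedP: (vP j); apply=> //; rewrite -eb 1?adj_sym //.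
    by rewrite m_sym.
  - rewrite eb (YP a) //; move/allowedP: (uP j); apply=> //; rewrite -eb 1?adj_sym //.
    by rewrite m_sym.
  - by rewrite !YP //; apply: pc => //; [move: aY|move: bY]; rewrite !inE => /andP [].
have degX : #|[set w in X | adj v w]| <= d.
  rewrite (_ : [set _ in _ | _] = set0) ?cards0 //.
  by apply/setP => w; rewrite !inE; apply/andP => -[/noNv /negPf ->].
have hB := @allowed_min_degree X c v degX.
have [p [q pq]] := disjoint_matchings d_gt2 cardT hB hB.
have vX' w : w \in v |: X -> (w == v) = false -> w \in X.
  by move=> + wv; rewrite !inE wv.
exists (fun w => if w == v then p else c w) => a b i j aX bX ab mij.
case: (eqVneq a v) => [ea|/negbTE av]; case: (eqVneq b v) => [eb|/negbTE bv].
- by move: ab; rewrite ea eb adj_irr.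
- have /noNv := vX' _ bX bv; by rewrite -ea ab.
- have /noNv := vX' _ aX av; by rewrite -eb adj_sym ab.
- by apply: pc => //; apply: vX'.
Qed.

Lemma packing : exists c, packed setT c.
Proof.
suff packX n : forall X : {set G}, #|X| = n -> exists c, packed X c by apply: packX.
elim: n => [X /cards0_eq ->|n IHn X cX].
  by exists (fun=> 1%g) => u v i j; rewrite inE.
have /card_gt0P [v vX] : 0 < #|X| by rewrite cX.
have [|c pc] := IHn (X :\ v); first by have := cardsD1 v X; rewrite vX cX; lia.
by rewrite -(setD1K vX); apply: packed_extend pc; rewrite !inE eqxx.
Qed.

End Packing.

(** * Bounds on the packing numbers *)

Lemma fold_cover_chromatic (G H : sgraph) (L : G -> {set H}) :
  4 <= max_degree G -> fold_cover (2 * max_degree G - 2) L ->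
  chromatic_number H = 2 * max_degree G - 2.
Proof.
set k := 2 * _ - 2 => hG [[partL nonadjL matchL cliqueL] cardL].
have [v0 _] : exists v0 : G, true.
  have [v0|G0] := pickP (@predT G); first by exists v0.
  by move: hG; rewrite /max_degree big_pred0.
(* With this [d], degree at least 4 gives [2 < d], degrees are at most [d.+1], and there are [d.*2]
   colours. *)
pose d := (max_degree G).-1.
have kd : k = d.*2 by rewrite /k /d; lia.
pose e (v : G) (i : 'I_k) := enum_val (cast_ord (esym (cardL v)) i).
have eL v i : e v i \in L v by apply: enum_valP.
have e_inj v : injective (e v) by move=> i j /enum_val_inj /cast_ord_inj.
have e_onto v x : x \in L v -> exists i, e v i = x.
  move=> xL; exists (cast_ord (cardL v) (enum_rank_in xL x)).
  by rewrite /e cast_ordK enum_rankK_in.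
pose m (u v : G) (i j : 'I_k) := adj (e u i) (e v j).
have [||v|u v i j|u v uv i j i' j'|c pc] := @packing G 'I_k d m.
- by rewrite /d; lia.
- by rewrite card_ord.
- have -> : d.+1 = max_degree G by rewrite /d; lia.
  exact: (leq_bigmax (F := fun v : G => #|[set w | adj v w]|)).
- exact: adj_sym.
- rewrite /m => h h'.
  have [h1 h2] := matchL u v _ _ _ _ uv (eL u i) (eL u i') (eL v j) (eL v j') h h'.
  by split=> eij; [apply: (e_inj v); apply: h1|apply: (e_inj u); apply: h2]; rewrite eij.
have [col colP] : exists col : H -> 'I_k, forall x, exists v i, e v i = x /\ c v i = col x.
  apply: (@fin_all_exists _ _ (fun x a => exists v i, e v i = x /\ c v i = a)) => x.
  have [v [xv _]] := partL x; have [i ei] := e_onto v x xv.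
  by exists (c v i), v, i.
rewrite /chromatic_number; case: ex_minnP => j /existsP [f fP] minj.
apply/eqP; rewrite eqn_leq; apply/andP; split.
  apply: minj; apply/existsP; exists [ffun x => col x].
  apply/forallP => x; apply/forallP => y; apply/implyP => xy; rewrite !ffunE.
  have [u [i [eu <-]]] := colP x; have [v [i' [ev <-]]] := colP y.
  have [uv|uv] := eqVneq u v.
    rewrite -uv (inj_eq perm_inj); apply: contraTneq xy => ii'.
    by rewrite -eu -ev -uv ii' adj_irr.
  apply: pc; rewrite ?inE //; last by rewrite /m eu ev.
  apply: contraTT xy => nuv.
  by apply: (nonadjL u v) => //; [rewrite -eu|rewrite -ev]; apply: eL.
(* Lower bound: the list of [v0] is a clique on [k] vertices. *)
rewrite -(cardL v0) -[j]card_ord.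
have injf : {in L v0 &, injective f}.
  move=> x y xL yL fxy; apply: contraTeq isT => xy.
  have /forallP /(_ y) /implyP /(_ (cliqueL v0 x y xL yL xy)) := forallP fP x.
  by rewrite fxy eqxx.
by rewrite -(card_in_imset injf); apply: max_card.
Qed.

(** Transfers a bound valid for all correspondence-covers to list-covers. Between lists of adjacent
    vertices, cover edges join equal values, hence form a matching. *)
Lemma list_cover_fold (G : sgraph) (k : nat) (L : G -> {fset nat}) :
  list_assignment k L ->
  @fold_cover G k (list_cover L) (fun v => [set a : list_cover L | tag a == v]).
Proof.
move=> cardL; split; last first.
  move=> v; rewrite -(cardL v) cardfE.
  have -> : [set a : list_cover L | tag a == v] =
      [set Tagged (fun v => L v : finType) x | x : L v].
    apply/setP => a; rewrite inE; apply/eqP/imsetP => [<-|[x _ ->]] //.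
    by case: a => w x; exists x.
  rewrite card_imset // => x y /eqP; rewrite eq_Tagged => /eqP; exact.
have ext (x y : list_cover_vertex L) :
    tag x = tag y -> val (tagged x) = val (tagged y) -> x = y.
  case: x => [w x]; case: y => [w' y] /= e; subst w'.
  by move/val_inj => ->.
split.
- by move=> a; exists (tag a); split=> [|v]; rewrite inE // => /eqP.
- move=> u v a b uv nuv; rewrite !inE => /eqP ea /eqP eb.
  have neq : (tag a == tag b) = false by rewrite ea eb (negPf uv).
  have nadj : adj (tag a) (tag b) = false by rewrite ea eb (negPf nuv).
  by rewrite /= /list_cover_adj neq nadj.
- move=> u v a a' b b' uv; rewrite !inE => /eqP ea /eqP ea' /eqP eb /eqP eb'.
  have nuv : (u == v) = false by apply: contraTF uv => /eqP ->; rewrite adj_irr.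
  have adjP (x y : list_cover_vertex L) :
      tag x = u -> tag y = v -> list_cover_adj x y -> val (tagged x) = val (tagged y).
    move=> ex ey; have -> : list_cover_adj x y = (val (tagged x) == val (tagged y)).
      have neq : (tag x == tag y) = false by rewrite ex ey.
      have isadj : adj (tag x) (tag y) by rewrite ex ey.
      by rewrite /list_cover_adj neq isadj.
    by move/eqP.
  move=> /(adjP _ _ ea eb) h /(adjP _ _ ea' eb') h'.
  split=> [e|e].
    by apply: ext; rewrite ?eb ?eb' // -h -h' e.
  by apply: ext; rewrite ?ea ?ea' // h h' e.
- move=> v a b; rewrite !inE => /eqP ea /eqP eb ab.
  have eqt : tag a == tag b by rewrite ea eb.
  rewrite /= /list_cover_adj eqt; apply/orP; left => /=.
  by apply: contraNneq ab => vab; apply/eqP/ext; rewrite ?ea ?eb.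
Qed.

(** [P] is an arbitrary proposition, in use quantified over all covers or all list-assignments, so
    the descent to a least value decides it classically. *)
Lemma least_positive_exists (P : nat -> Prop) (n : nat) :
  0 < n -> P n -> exists2 k, least_positive P k & k <= n.
Proof.
elim/ltn_ind: n => n IHn n0 Pn.
have [[j [j0 jn Pj]]|noj] := classic (exists j, [/\ 0 < j, j < n & P j]).
  by have [k lk kj] := IHn j jn j0 Pj; exists k; [|exact: leq_trans kj (ltnW jn)].
exists n => //; split=> // j j0 Pj; rewrite leqNgt; apply/negP => jn.
by apply: noj; exists j.
Qed.

Theorem theorem6 (G : sgraph) (hG : 4 <= max_degree G) :
  exists kl kc : nat,
    [/\ is_list_packing_number G kl,
        is_correspondence_packing_number G kc
      & kl <= kc <= 2 * max_degree G - 2].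
Proof.
have [|kc lkc kc_le] := @least_positive_exists
    (fun k => forall (H : sgraph) (L : G -> {set H}), fold_cover k L -> chromatic_number H = k)
    (2 * max_degree G - 2) _ (fun H L => @fold_cover_chromatic G H L hG).
  by lia.
have [kc0 Pkc _] := lkc.
have [kl lkl kl_le] := @least_positive_exists
    (fun k => forall L : G -> {fset nat},
       list_assignment k L -> chromatic_number (list_cover L) = k)
    kc kc0 (fun L hL => Pkc _ _ (list_cover_fold hL)).
by exists kl, kc; split=> //; rewrite kl_le.
Qed.
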